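(* Let $\mathbf{x}\in\{0,1\}^\omega$ be a one-sided infinite binary word beginning with $01$. Then $\mathbf{x}$ is good if and only if $\mathbf{x}=01\bullet\mathbf{f}$ for some $\mathbf{f}\in F$.
   Context: A factor of a word is a finite contiguous subword. A word $w$ encounters a pattern $p\in\{0,1\}^*$ if $g(p)$ is a factor of $w$ for some non-erasing morphism $g:\{0,1\}^*\to\{0,1\}^*$ (i.e. $g(0),g(1)$ non-empty). A (finite or one-sided infinite) binary word is good if it contains neither $11$ nor $1001$ as a factor, and encounters neither of the patterns $0000$ and $00010100$. Let $\delta$ be the morphism with $\delta(0)=01$, $\delta(1)=00$. Operators. Suppose a finite binary word $w$ has a suffix $\delta^n(01)$ for some $n\ge 0$; let $n$ be as large as possible and write $w=y\,\delta^n(01)$. Define $\alpha(w)=w\,\delta^n(00)=y\,\delta^{n+1}(01)$, $\beta(w)=w\,\delta^n(0100)=y\,\delta^{n+1}(001)$, $\gamma(w)=w\,\delta^n(010100)=y\,\delta^{n+1}(0001)$. Let $B=\{\alpha,\beta,\gamma\}$. For $\mathbf{f}=f_1f_2f_3\cdots\in B^\omega$ and such a $w$, the word $w$ is a proper prefix of $f_1(w)$, which is a proper prefix of $f_2(f_1(w))$, and so on; $w\bullet\mathbf{f}$ denotes the one-sided infinite word having all of $f_n(f_{n-1}(\cdots f_1(w)\cdots))$, $n\ge1$, as prefixes. The set $F$. Let $A_{01}$ be the automaton with states $a,b,c,d$, initial state $a$, and exactly the following labelled transitions: $a\xrightarrow{\alpha}a$, $a\xrightarrow{\beta}b$, $a\xrightarrow{\gamma}c$;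 $b\xrightarrow{\beta}b$, $b\xrightarrow{\alpha}d$, $b\xrightarrow{\gamma}c$; $c\xrightarrow{\gamma}c$, $c\xrightarrow{\alpha}d$; $d\xrightarrow{\alpha}b$, $d\xrightarrow{\beta}c$. Let $F\subseteq B^\omega$ be the set of label sequences of infinite paths in $A_{01}$ starting at $a$. *)

(* Defs.v *)
From mathcomp Require Import all_boot.

Set Implicit Arguments.
Unset Strict Implicit.
Unset Printing Implicit Defensive.

(* The letters 0 and 1 are [false] and [true]. *)
Definition word := seq bool.
Definition iword := nat -> bool.

Definition prefix_of (u : word) (x : iword) : Prop := u = mkseq x (size u).

Definition factor_of (u : word) (x : iword) : Prop :=
  exists i, u = mkseq (fun j => x (i + j)) (size u).

(* A morphism of the free monoid {0,1}* is given by the images of the letters. *)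
Definition morph (g : bool -> word) (u : word) : word := flatten (map g u).

Definition nonerasing (g : bool -> word) : Prop := forall a, g a <> [::].

Definition encounters (x : iword) (p : word) : Prop :=
  exists g, nonerasing g /\ factor_of (morph g p) x.

Definition good (x : iword) : Prop :=
  [/\ ~ factor_of [:: true; true] x,
      ~ factor_of [:: true; false; false; true] x,
      ~ encounters x [:: false; false; false; false] &
      ~ encounters x [:: false; false; false; true; false; true; false; false]].

Definition delta (u : word) : word :=
  morph (fun a => if a then [:: false; false] else [:: false; true]) u.

Definition deltan (n : nat) (u : word) : word := iter n delta u.

(* The largest n such that w has suffix delta^n(01); such an n is less than
   size w, since delta^n(01) has length 2^(n+1).  The value is 0 when there is
   no such n, where the operators below are not meant to be used. *)
Definition level (w : word) : nat :=
  \max_(n < size w | suffix (deltan n [:: false; true]) w) n.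

Inductive op := Alpha | Beta | Gamma.

Definition op_tail (f : op) : word :=
  match f with
  | Alpha => [:: false; false]
  | Beta => [:: false; true; false; false]
  | Gamma => [:: false; true; false; true; false; false]
  end.

Definition apply_op (f : op) (w : word) : word :=
  w ++ deltan (level w) (op_tail f).

(* f_n (f_(n-1) (... f_1 (w))), where f_(i+1) is [f i]. *)
Fixpoint apply_ops (f : nat -> op) (n : nat) (w : word) : word :=
  if n is m.+1 then apply_op (f m) (apply_ops f m w) else w.

(* x = w \bullet f *)
Definition is_bullet (w : word) (f : nat -> op) (x : iword) : Prop :=
  forall n, 0 < n -> prefix_of (apply_ops f n w) x.

Inductive state := Sa | Sb | Sc | Sd.

Inductive trans : state -> op -> state -> Prop :=
  | trans_aa : trans Sa Alpha Sa
  | trans_ab : trans Sa Beta Sb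
  | trans_ac : trans Sa Gamma Sc
  | trans_bb : trans Sb Beta Sb
  | trans_bd : trans Sb Alpha Sd
  | trans_bc : trans Sb Gamma Sc
  | trans_cc : trans Sc Gamma Sc
  | trans_cd : trans Sc Alpha Sd
  | trans_db : trans Sd Alpha Sb
  | trans_dc : trans Sd Beta Sc.

Definition in_F (f : nat -> op) : Prop :=
  exists q : nat -> state, q 0 = Sa /\ forall n, trans (q n) (f n) (q n.+1).

Lemma delta_cat u v : delta (u ++ v) = delta u ++ delta v.
Proof. by rewrite /delta /morph map_cat flatten_cat. Qed.

Lemma deltan_cat n u v : deltan n (u ++ v) = deltan n u ++ deltan n v.
Proof. by elim: n => //= n ->; rewrite delta_cat. Qed.

Lemma size_delta u : size (delta u) = 2 * size u.
Proof. by elim: u => //= -[] u; rewrite /= mulnS => <-. Qed.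

Lemma size_deltan n u : size (deltan n u) = 2 ^ n * size u.
Proof. by elim: n => [|n IH] /=; rewrite ?mul1n // size_delta IH expnS mulnA. Qed.

Lemma suffix_lt_size n w :
  suffix (deltan n [:: false; true]) w -> n < size w.
Proof.
move=> /suffixP[y ->]; rewrite size_cat size_deltan muln2 -addnn.
apply: leq_trans (leq_addl _ _); apply: leq_trans (leq_addr _ _).
exact: ltn_expl.
Qed.

Lemma levelP w n0 : suffix (deltan n0 [:: false; true]) w ->
  suffix (deltan (level w) [:: false; true]) w /\
  forall n, suffix (deltan n [:: false; true]) w -> n <= level w.
Proof.
move=> s0; split.
  have Hn := suffix_lt_size s0.
  rewrite /level (bigmax_eq_arg (Ordinal Hn)) //.
  by case: arg_maxnP.
move=> n sn; have Hn := suffix_lt_size sn.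
exact: (leq_bigmax_cond (Ordinal Hn)).
Qed.

Lemma apply_opE f y w : w = y ++ deltan (level w) [:: false; true] ->
  apply_op f w = y ++ deltan (level w).+1
    match f with
    | Alpha => [:: false; true]
    | Beta => [:: false; false; true]
    | Gamma => [:: false; false; false; true]
    end.
Proof.
move=> e; rewrite /apply_op; set n := level w in e *.
by rewrite e -catA -deltan_cat /deltan iterSr; case: f.
Qed.

Lemma size_apply_op f w : size w < size (apply_op f w).
Proof.
rewrite /apply_op size_cat -[X in X < _]addn0 ltn_add2l size_deltan muln_gt0.
by rewrite expn_gt0; case: f.
Qed.

Lemma size_apply_ops f n w : n <= size (apply_ops f n w).
Proof. by elim: n => //= n IH; apply: leq_ltn_trans IH (size_apply_op _ _). Qed.

Lemma prefix_apply_ops f m n w :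
  m <= n -> prefix (apply_ops f m w) (apply_ops f n w).
Proof.
move=> /subnKC <-; elim: (n - m) => [|k IH]; first by rewrite addn0 prefix_refl.
by rewrite addnS /=; apply: prefix_trans IH (prefix_prefix _ _).
Qed.

Lemma is_bullet_exists w f : exists x, is_bullet w f x.
Proof.
exists (fun i => nth false (apply_ops f i.+1 w) i) => n _.
apply: (@eq_from_nth _ false) => [|i Hi]; first by rewrite size_mkseq.
rewrite nth_mkseq //; have Hi1 := size_apply_ops f i.+1 w.
case: (leqP i.+1 n) => Hn.
  by have /prefixP[s ->] := prefix_apply_ops f w Hn; rewrite nth_cat Hi1.
have /prefixP[s ->] := prefix_apply_ops f w (ltnW Hn).
by rewrite nth_cat Hi.
Qed.

Lemma is_bullet_unique w f x x' :
  is_bullet w f x -> is_bullet w f x' -> x =1 x'.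
Proof.
move=> Hx Hx' i; have Hi := size_apply_ops f i.+1 w.
have := congr1 (fun s => nth false s i) (etrans (esym (Hx i.+1 isT)) (Hx' i.+1 isT)).
by rewrite /= !nth_mkseq.
Qed.

(* Main.v *)
Require Import Defs.
From mathcomp Require Import all_boot.
From mathcomp Require Import zify.

(** In a good word the letters 1 lie at positions of a single parity, so a good
    word x beginning with 01 is delta(w), where w = u y with y beginning with 01
    and u one of the empty word, 0 and 00; u tells which of alpha, beta, gamma is
    applied first, and y is decoded in the same way.  The states a, b, c, d of
    the automaton stand for the conditions that y, 0y, 00y, 1y, respectively,
    be good, and the transitions express how such a condition on delta(u y) is
    inherited by y.

    For the converse, goodness is measured on prefixes: if a forbidden pattern
    occurs in the first N letters of the word attached to one state of a path,
    then one occurs in the first (N+1)/2 letters of the word attached to the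
    next state, which cannot go on forever. *)

Set Implicit Arguments.
Unset Strict Implicit.
Unset Printing Implicit Defensive.

(** * Forbidden patterns in prefixes *)

Definition eqs (x : iword) a b n := forall j, j < n -> x (a + j) = x (b + j).

Lemma eqsE x a b n i j :
  eqs x a b n -> a <= i < a + n -> j + a = i + b -> x i = x j.
Proof.
move=> e Hi Hj; have /e : i - a < n by lia.
rewrite subnKC; last by lia.
by have -> : b + (i - a) = j by lia.
Qed.

Lemma eqs_sub x a b n a' b' n' : eqs x a b n ->
  a <= a' -> a' + n' <= a + n -> a' + b = b' + a -> eqs x a' b' n'.
Proof. by move=> e *; move=> j Hj; apply: eqsE e _ _; lia. Qed.

(* A forbidden pattern lies within the first N letters of x; in the encounter
   of 00010100, k and l are the lengths of the images of 0 and 1. *)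
Variant bad (x : iword) N : Prop :=
  | Bad11 i of i + 2 <= N & x i & x i.+1
  | Bad1001 i of i + 4 <= N & x i & ~~ x i.+1 & ~~ x i.+2 & x i.+3
  | BadPow4 i k of 0 < k & i + 4 * k <= N & eqs x i (i + k) (3 * k)
  | BadPat i k l of 0 < k & 0 < l & i + (6 * k + 2 * l) <= N
      & eqs x i (i + k) (2 * k)
      & eqs x (i + 2 * k) (i + 3 * k + l) (k + l)
      & eqs x i (i + 4 * k + 2 * l) (2 * k).

Lemma bad_leq x M N : M <= N -> bad x M -> bad x N.
Proof.
move=> MN [i|i|i k|i k l] *;
  [apply: (@Bad11 x N i) | apply: (@Bad1001 x N i) | apply: (@BadPow4 x N i k)
  | apply: (@BadPat x N i k l)] => //; lia.
Qed.

Lemma bad_ext x y N : x =1 y -> bad x N -> bad y N.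
Proof.
have E a b n : x =1 y -> eqs x a b n -> eqs y a b n.
  by move=> xy e j /e; rewrite !xy.
by move=> xy [i|i|i k|i k l];
  [move=> ? | move=> ? | move=> ? ? /(E _ _ _ xy) ?
  | move=> ? ? ? /(E _ _ _ xy)? /(E _ _ _ xy)? /(E _ _ _ xy)?]; rewrite ?xy => *;
  [apply: (@Bad11 y N i) | apply: (@Bad1001 y N i) | apply: (@BadPow4 y N i k)
  | apply: (@BadPat y N i k l)].
Qed.

(** * Encounters as equalities between blocks *)

Definition factor_at (u : word) (x : iword) i :=
  u = mkseq (fun j => x (i + j)) (size u).

Lemma factor_atP u x i :
  factor_at u x i <-> forall j, j < size u -> x (i + j) = nth false u j.
Proof.
split=> [e j Hj|e]; first by rewrite e nth_mkseq.
apply: (@eq_from_nth _ false) => [|j Hj]; first by rewrite size_mkseq.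
by rewrite nth_mkseq // e.
Qed.

Lemma factor_at_cat u v x i :
  factor_at (u ++ v) x i <-> factor_at u x i /\ factor_at v x (i + size u).
Proof.
rewrite !factor_atP size_cat; split=> [e|[eu ev] j Hj].
  split=> j Hj; first by rewrite e ?nth_cat ?Hj //; lia.
  rewrite -addnA e ?ltn_add2l // nth_cat ifF; first by congr nth; lia.
  by lia.
rewrite nth_cat; case: ltnP => Hu; first exact: eu.
by rewrite -ev; [congr x|]; lia.
Qed.

Lemma factor_at_eqs u x i j : factor_at u x i -> factor_at u x j ->
  eqs x i j (size u).
Proof. by move=> /factor_atP ei /factor_atP ej k Hk; rewrite ei // ej. Qed.

Lemma factor_at_mkseq x i j k :
  eqs x i j k -> factor_at (mkseq (fun t => x (i + t)) k) x j.
Proof.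
by move=> e; apply/factor_atP=> t; rewrite size_mkseq => Ht; rewrite nth_mkseq ?e.
Qed.

Lemma eqs_cat x a b m n :
  eqs x a b m -> eqs x (a + m) (b + m) n -> eqs x a b (m + n).
Proof.
move=> e1 e2 j Hj; case: (ltnP j m) => Hm; first exact: e1.
have /e2 : j - m < n by lia.
by rewrite -!addnA subnKC.
Qed.

Lemma eqs_trans x a b c n : eqs x a b n -> eqs x b c n -> eqs x a c n.
Proof. by move=> e1 e2 j Hj; rewrite e1 ?e2. Qed.

Lemma nonempty_size (T : Type) (s : seq T) : s <> [::] -> 0 < size s.
Proof. by case: s. Qed.

Lemma encounters0000 x : encounters x [:: false; false; false; false] <->
  exists i k, 0 < k /\ eqs x i (i + k) (3 * k).
Proof.
split=> [[g [g0 [i]]]|[i [k [k0 e]]]].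
  rewrite /morph /= cats0 -/(factor_at _ _ _).
  rewrite !factor_at_cat => -[e1 [e2 [e3 e4]]].
  exists i, (size (g false)); split; first exact: nonempty_size.
  by apply: eqs_sub (eqs_cat (factor_at_eqs e1 e2)
    (eqs_cat (factor_at_eqs e2 e3) (factor_at_eqs e3 e4))) _ _ _; lia.
exists (fun=> mkseq (fun t => x (i + t)) k); split=> [a|].
  by move/(congr1 size); rewrite size_mkseq => k1; rewrite k1 in k0.
exists i; rewrite /morph /= cats0 -/(factor_at _ _ _).
have e1 : eqs x i (i + k) k by apply: eqs_sub e _ _ _; lia.
have e2 : eqs x (i + k) (i + k + k) k by apply: eqs_sub e _ _ _; lia.
have e3 : eqs x (i + k + k) (i + k + k + k) k by apply: eqs_sub e _ _ _; lia.
rewrite !factor_at_cat size_mkseq; do ![split]; apply: factor_at_mkseq => //.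
  exact: eqs_trans e1 e2.
exact: eqs_trans e1 (eqs_trans e2 e3).
Qed.

(** With X and Y the images of 0 and 1, the word XXXYXYXX is characterised by XXX having period |X|,
    the two factors XY agreeing, and the last XX repeating the first. *)
Lemma encounters00010100 x :
  encounters x [:: false; false; false; true; false; true; false; false] <->
  exists i k l, [/\ 0 < k, 0 < l, eqs x i (i + k) (2 * k),
    eqs x (i + 2 * k) (i + 3 * k + l) (k + l) &
    eqs x i (i + 4 * k + 2 * l) (2 * k)].
Proof.
split=> [[g [g0 [i]]]|[i [k [l [k0 l0 e1 e2 e3]]]]].
  rewrite /morph /= cats0 -/(factor_at _ _ _).
  set X := g false; set Y := g true; rewrite !factor_at_cat.
  move=> [x1 [x2 [x3 [y1 [x4 [y2 [x5 x6]]]]]]].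
  exists i, (size X), (size Y); split; try exact: nonempty_size (g0 _).
  - by apply: eqs_sub (eqs_cat (factor_at_eqs x1 x2) (factor_at_eqs x2 x3)) _ _ _;
      lia.
  - by apply: eqs_sub (eqs_cat (factor_at_eqs x3 x4) (factor_at_eqs y1 y2)) _ _ _;
      lia.
  - by apply: eqs_sub (eqs_cat (factor_at_eqs x1 x5) (factor_at_eqs x2 x6)) _ _ _;
      lia.
exists (fun a : bool => if a then mkseq (fun t => x (i + 3 * k + t)) l
  else mkseq (fun t => x (i + t)) k); split=> [[]|].
- by move/(congr1 size); rewrite size_mkseq => E; rewrite E in l0.
- by move/(congr1 size); rewrite size_mkseq => E; rewrite E in k0.
exists i; rewrite /morph /= cats0 -/(factor_at _ _ _).
have s1 : eqs x i (i + k) k by apply: eqs_sub e1 _ _ _; lia.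
have s2 : eqs x i (i + k + k) k.
  by apply: eqs_trans s1 _; apply: eqs_sub e1 _ _ _; lia.
have s3 : eqs x i (i + k + k + k + l) k.
  by apply: eqs_trans s2 _; apply: eqs_sub e2 _ _ _; lia.
have s4 : eqs x (i + 3 * k) (i + k + k + k + l + k) l.
  by apply: eqs_sub e2 _ _ _; lia.
have s5 : eqs x i (i + k + k + k + l + k + l) k.
  by apply: eqs_sub e3 _ _ _; lia.
have s6 : eqs x i (i + k + k + k + l + k + l + k) k.
  by apply: eqs_trans s1 _; apply: eqs_sub e3 _ _ _; lia.
have s0 : eqs x (i + 3 * k) (i + k + k + k) l.
  by have -> : i + k + k + k = i + 3 * k by lia.
rewrite !factor_at_cat !size_mkseq; do ![split]; exact: factor_at_mkseq.
Qed.

Lemma goodP x : good x <-> forall N, ~ bad x N.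
Proof.
split=> [[n11 n1001 n4 n8] N|nb].
  case=> [i _ x0 x1|i _ x0 x1 x2 x3|i k k0 _ e|i k l k0 l0 _ e1 e2 e3].
  - apply: n11; exists i; apply/factor_atP.
    by move=> [|[|//]] _; rewrite ?addn0 ?addn1.
  - apply: n1001; exists i; apply/factor_atP.
    move=> [|[|[|[|//]]]] _; rewrite ?addn0 ?addn1 ?addn2 ?addn3 //=;
      exact: negbTE.
  - by apply: n4; apply/encounters0000; exists i, k.
  - by apply: n8; apply/encounters00010100; exists i, k, l.
split.
- move=> [i /factor_atP e]; apply: (nb (i + 2)).
  apply: (@Bad11 _ _ i) => //.
  + by have := e 0 isT; rewrite addn0 => ->.
  + by have := e 1 isT; rewrite addn1 => ->.
- move=> [i /factor_atP e]; apply: (nb (i + 4)).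
  apply: (@Bad1001 _ _ i) => //.
  + by have := e 0 isT; rewrite addn0.
  + by have := e 1 isT; rewrite addn1 => ->.
  + by have := e 2 isT; rewrite addn2 => ->.
  + by have := e 3 isT; rewrite addn3 => ->.
- by move=> /encounters0000[i [k [k0 e]]]; apply: (nb (i + 4 * k)); apply: BadPow4 e.
- move=> /encounters00010100[i [k [l [k0 l0 e1 e2 e3]]]].
  by apply: (nb (i + (6 * k + 2 * l))); apply: BadPat e1 e2 e3.
Qed.

(** * Patterns in delta(w) *)

Definition idelta (w : iword) : iword := fun i => odd i && ~~ w i./2.

Lemma idelta_even w i : ~~ odd i -> idelta w i = false.
Proof. by rewrite /idelta => /negbTE ->. Qed.

Lemma idelta_true w i : idelta w i -> odd i.
Proof. by case/andP. Qed.

Lemma idelta_odd w i m : i = 2 * m + 1 -> idelta w i = ~~ w m.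
Proof.
move=> Hi; rewrite /idelta; have -> : odd i by lia.
by have -> : i./2 = m by lia.
Qed.

(* Letters 1 occur only at odd positions, so two equal blocks at an odd
   distance consist of zeros. *)
Lemma eqs_idelta_odd w a b n i :
  odd (a + b) -> eqs (idelta w) a b n -> a <= i < a + n -> idelta w i = false.
Proof.
move=> ab e Hi; have E : idelta w i = idelta w (i + b - a).
  by apply: (eqsE e Hi); lia.
case: (boolP (odd i)) => Hodd; last exact: idelta_even.
by rewrite E idelta_even //; lia.
Qed.

Lemma zeros4_idelta w i N : i + 4 <= N ->
  (forall j, i <= j < i + 4 -> idelta w j = false) -> bad w N./2.
Proof.
move=> HN z; apply: (@Bad11 _ _ i./2); first by lia.
  by apply: negbFE; rewrite -(idelta_odd w (i := 2 * i./2 + 1)) ?z //; lia.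
by apply: negbFE; rewrite -(idelta_odd w (i := 2 * i./2.+1 + 1)) ?z //; lia.
Qed.

(** A window of length 2n holds n odd positions whatever the parity of its start, and these carry
    the complemented letters of [w]; starts of equal parity keep them aligned. *)
Lemma eqs_idelta_half w a b n : ~~ odd (a + b) ->
  eqs (idelta w) a b (2 * n) -> eqs w a./2 b./2 n.
Proof.
move=> ab e j Hj; apply: negb_inj.
rewrite -(idelta_odd w (i := 2 * (a./2 + j) + 1)) //.
rewrite -(idelta_odd w (i := 2 * (b./2 + j) + 1)) //.
by apply: eqsE e _ _; lia.
Qed.

Lemma zeros4_bad w i N : i + 4 <= N ->
  (forall j, i <= j < i + 4 -> w j = false) -> bad w N.
Proof.
move=> HN z; apply: (@BadPow4 _ _ i 1) => //.
by move=> j Hj; rewrite !z //; lia.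
Qed.

(** Here [w] has a factor 1ZZ1 with |Z| = [q]. Avoiding 11 forces Z to begin and end with 0, so ZZ
    has 00 in its middle; |Z| = 1 then gives 1001 and |Z| = 2 gives 0000. *)
Lemma bad_1ZZ1 (w : iword) a q N : 0 < q -> a + 2 * q + 2 <= N ->
  w a -> w (a + 2 * q + 1) -> eqs w a.+1 (a.+1 + q) q -> bad w N.
Proof.
move=> q0 HN wa wb e.
have E i j : a.+1 <= i < a.+1 + q -> j = i + q -> w i = w j.
  by move=> Hi Hj; apply: eqsE e Hi _; lia.
case w1: (w a.+1); first by apply: (@Bad11 _ _ a) => //; lia.
case w2: (w (a + 2 * q)).
  apply: (@Bad11 _ _ (a + 2 * q)) => //.
  by have -> : (a + 2 * q).+1 = a + 2 * q + 1 by lia.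
have w3 : w (a + q) = false by rewrite (E _ (a + 2 * q)) //; lia.
have w4 : w (a + q + 1) = false by rewrite -(E a.+1) //; lia.
have [q1|q1] := leqP q 1.
  apply: (@Bad1001 _ _ a); rewrite ?w1 //; first by lia.
    by rewrite (_ : a.+2 = a + q + 1) ?w4 //; lia.
  by have -> : a.+3 = a + 2 * q + 1 by lia.
have [q2|q2] := leqP q 2.
  apply: (@zeros4_bad _ a.+1) => [|j Hj]; first by lia.
  have : [|| j == a.+1, j == a + q, j == a + q + 1 | j == a + 2 * q] by lia.
  by case/or4P => /eqP ->.
(* Two 1s around the central 00 give 1001. A 0 on the right makes Z begin with 00, a 0 on the left
   makes it end with 00; the next letter of Z then yields 1001 with an outer 1, or 0000 at the
   centre. *)
case w5: (w (a + q - 1)); case w6: (w (a + q + 2)).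
- apply: (@Bad1001 _ _ (a + q - 1)) => //; first by lia.
  + by rewrite (_ : (a + q - 1).+1 = a + q) ?w3 //; lia.
  + by rewrite (_ : (a + q - 1).+2 = a + q + 1) ?w4 //; lia.
  + by have -> : (a + q - 1).+3 = a + q + 2 by lia.
- have w7 : w (a + 2) = false by rewrite (E _ (a + q + 2)) //; lia.
  case w8 : (w (a + 3)).
    apply: (@Bad1001 _ _ a); rewrite ?w1 //; first by lia.
      by rewrite (_ : a.+2 = a + 2) ?w7 //; lia.
    by have -> : a.+3 = a + 3 by lia.
  have w9 : w (a + q + 3) = false by rewrite -(E (a + 3)) //; lia.
  apply: (@zeros4_bad _ (a + q)) => [|j Hj]; first by lia.
  have : [|| j == a + q, j == a + q + 1, j == a + q + 2 | j == a + q + 3] by lia.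
  by case/or4P => /eqP ->.
all: have w7 : w (a + 2 * q - 1) = false by rewrite -(E (a + q - 1)) //; lia.
all: case w8 : (w (a + 2 * q - 2)).
1,3: apply: (@Bad1001 _ _ (a + 2 * q - 2)); rewrite ?w8 //; first by lia.
1,4: by rewrite (_ : (a + 2 * q - 2).+1 = a + 2 * q - 1) ?w7 //; lia.
1,3: by rewrite (_ : (a + 2 * q - 2).+2 = a + 2 * q) ?w2 //; lia.
1,2: by have -> : (a + 2 * q - 2).+3 = a + 2 * q + 1 by lia.
all: have w9 : w (a + q - 2) = false by rewrite (E _ (a + 2 * q - 2)) //; lia.
all: apply: (@zeros4_bad _ (a + q - 2)) => [|j Hj]; first by lia.
all: have : [|| j == a + q - 2, j == a + q - 1, j == a + q | j == a + q + 1] by lia.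
all: by case/or4P => /eqP ->.
Qed.

(** Since 1 occurs only at odd positions, 11 and 1001 are impossible. If all block lengths are even,
    the repetition halves; an odd distance between equal blocks makes them zero, which mostly gives
    four zeros in a row, hence 11 in [w]. *)
Lemma bad_idelta w N : bad (idelta w) N -> bad w N./2.
Proof.
case=> [i HN x0 x1|i HN x0 x1 x2 x3|i k k0 HN e|i k l k0 l0 HN e1 e2 e3].
- by have := idelta_true x0; have := idelta_true x1; lia.
- by have := idelta_true x0; have := idelta_true x3; lia.
- case: (boolP (odd k)) => Hk.
    have z j : i <= j < i + 3 * k -> idelta w j = false.
      by apply: eqs_idelta_odd e; lia.
    apply: (@zeros4_idelta _ i) => [|j Hj]; first by lia.
    have [Hj2|Hj2] := ltnP j (i + 3 * k); first by rewrite z //; lia.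
    by rewrite -(eqsE e (i := j - k)) ?z //; lia.
  apply: (@BadPow4 _ _ i./2 k./2); try lia.
  have -> : i./2 + k./2 = (i + k)./2 by lia.
  by apply: eqs_idelta_half; [lia | apply: eqs_sub e _ _ _; lia].
case: (boolP (odd k)) => Hk.
  have z j : i <= j < i + 2 * k -> idelta w j = false.
    by apply: eqs_idelta_odd e1; lia.
  have z' j : i + k <= j < i + 3 * k -> idelta w j = false.
    by move=> Hj; rewrite -(eqsE e1 (i := j - k)) ?z //; lia.
  case z3: (idelta w (i + 3)); last first.
    apply: (@zeros4_idelta _ i) => [|j Hj]; first by lia.
    have [Hj2|Hj2] := ltnP j (i + 3 * k).
      by have [Hj3|Hj3] := ltnP j (i + 2 * k); [apply: z | apply: z']; lia.
    by have -> : j = i + 3 by lia.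
  have k1 : k = 1.
    have [k1|k1] := leqP k 1; first by lia.
    by have [k3|k3] := leqP k 3; [rewrite z' in z3 | rewrite z in z3]; lia.
  (* What remains is 000Y0Y00 with |Y| odd and [i] even: it splits as 00, 0Y, 0Y, 00, which is
     delta(1ZZ1). *)
  subst k; case: (boolP (odd l)) => Hl; last first.
    by rewrite (eqs_idelta_odd _ e2) in z3; lia.
  have Hi : ~~ odd i by apply/negP => Hi; rewrite idelta_even in z3; lia.
  apply: (@bad_1ZZ1 _ i./2 l.+1./2); try lia.
  + by apply/negPn; rewrite -(idelta_odd w (i := i + 1)) ?z //; lia.
  + apply/negPn; rewrite -(idelta_odd w (i := i + 2 * l + 5)); last by lia.
    by rewrite -(eqsE e3 (i := i + 1)) ?z //; lia.
  + have -> : i./2.+1 = (i + 2)./2 by lia.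
    have -> : (i + 2)./2 + l.+1./2 = (i + 3 + l)./2 by lia.
    by apply: eqs_idelta_half; [lia | apply: eqs_sub e2 _ _ _; lia].
case: (boolP (odd l)) => Hl.
  have z j : i + 2 * k <= j < i + 3 * k + l -> idelta w j = false.
    by move=> Hj; apply: (eqs_idelta_odd _ e2); lia.
  have z' j : i + k <= j < i + 3 * k -> idelta w j = false.
    move=> Hj; have [Hj2|Hj2] := leqP (i + 2 * k) j; first by rewrite z //; lia.
    by rewrite (eqsE e1 (j := j + k)) ?z //; lia.
  by apply: (@zeros4_idelta _ (i + k)) => [|j Hj]; rewrite ?z' //; lia.
apply: (@BadPat _ _ i./2 k./2 l./2); try lia.
- have -> : i./2 + k./2 = (i + k)./2 by lia.
  by apply: eqs_idelta_half; [lia | apply: eqs_sub e1 _ _ _; lia].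
- have -> : i./2 + 2 * k./2 = (i + 2 * k)./2 by lia.
  have -> : i./2 + 3 * k./2 + l./2 = (i + 3 * k + l)./2 by lia.
  by apply: eqs_idelta_half; [lia | apply: eqs_sub e2 _ _ _; lia].
have -> : i./2 + 4 * k./2 + 2 * l./2 = (i + 4 * k + 2 * l)./2 by lia.
by apply: eqs_idelta_half; [lia | apply: eqs_sub e3 _ _ _; lia].
Qed.

(** * Words with letters prepended or removed *)

Definition icons a (x : iword) : iword := fun i => if i is j.+1 then x j else a.
Definition iapp (u : word) (x : iword) : iword := foldr icons x u.
Definition itail (x : iword) : iword := fun i => x i.+1.

Lemma icons_ext a x y : x =1 y -> icons a x =1 icons a y.
Proof. by move=> e []. Qed.

Lemma iapp_ext u x y : x =1 y -> iapp u x =1 iapp u y.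
Proof. by move=> e; elim: u => //= a u; apply: icons_ext. Qed.

Lemma idelta_ext x y : x =1 y -> idelta x =1 idelta y.
Proof. by move=> e i; rewrite /idelta e. Qed.

Lemma idelta_icons a x :
  idelta (icons a x) =1 icons false (icons (~~ a) (idelta x)).
Proof. by move=> [|[|i]] //=; rewrite /idelta /= negbK. Qed.

Lemma bad_icons a x N : bad x N -> bad (icons a x) N.+1.
Proof.
case=> [i HN x0 x1|i HN x0 x1 x2 x3|i k k0 HN e|i k l k0 l0 HN e1 e2 e3].
- exact: (@Bad11 _ _ i.+1).
- exact: (@Bad1001 _ _ i.+1).
- exact: (@BadPow4 _ _ i.+1 k).
- exact: (@BadPat _ _ i.+1 k l).
Qed.

Lemma good_ext x y : x =1 y -> good x -> good y.
Proof.
move=> e /goodP g; apply/goodP => N /(bad_ext (fsym e)); exact: g.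
Qed.

Lemma good_icons a x : good (icons a x) -> good x.
Proof. by move=> /goodP g; apply/goodP => N /(@bad_icons a); apply: g. Qed.

Lemma good_iapp u x : good (iapp u x) -> good x.
Proof. by elim: u => //= a u IH /good_icons. Qed.

Lemma eqs_itail_idelta w a b n :
  eqs w a b n -> eqs (itail (idelta w)) (2 * a) (2 * b) (2 * n).
Proof.
move=> e j Hj; rewrite /itail; case: (boolP (odd j)) => Hodd.
  by rewrite !idelta_even //; lia.
rewrite (idelta_odd w (m := a + j./2)) ?(idelta_odd w (m := b + j./2)); try lia.
by rewrite e //; lia.
Qed.

Lemma bad_00010100 (x : iword) i N : i + 8 <= N ->
  (forall j, j < 8 -> x (i + j) =
    nth false [:: false; false; false; true; false; true; false; false] j) ->
  bad x N.
Proof.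
move=> HN E; apply: (@BadPat _ _ i 1 1) => //.
- by case=> [|[|//]] _; rewrite -!addnA !E.
- by case=> [|[|//]] _; rewrite -!addnA !E.
- by case=> [|[|//]] _; rewrite -!addnA !E.
Qed.

(* Each even position of a word delta(w) holds 0, so every repetition of
   delta(w) made of images of letters can be shifted to the right by one. *)
Lemma bad_itail_idelta w N : ~~ [&& w 0, ~~ w 1, ~~ w 2 & w 3] ->
  bad w N -> bad (itail (idelta w)) (2 * N).
Proof.
move=> w1001 [i HN x0 x1|[|i] HN x0 x1 x2 x3|i k k0 HN e|i k l k0 l0 HN e1 e2 e3].
(* delta(11) = 0000 is followed by the 0 of an even position, so 0000 also occurs one step to the
   right. *)
- apply: (@zeros4_bad _ (2 * i)) => [|j Hj]; first by lia.
  rewrite /itail; case: (boolP (odd j)) => Hodd; first by rewrite idelta_even //; lia.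
  have [?|?] := leqP j (2 * i); first by rewrite (idelta_odd w (m := i)) ?x0 //; lia.
  by rewrite (idelta_odd w (m := i.+1)) ?x1 //; lia.
- by rewrite x0 x1 x2 x3 in w1001.
(* delta(1001) is 00010100 itself. It cannot be shifted, which is why 1001 at position 0 is
   excluded. *)
- apply: (@bad_00010100 _ (2 * i).+1) => [|j Hj]; first by lia.
  rewrite /itail; case: (boolP (odd j)) => Hodd; last first.
    by rewrite idelta_even; [move: j Hj Hodd; do 8?[case=> //] | lia].
  rewrite (idelta_odd w (m := i.+1 + j./2)); last by lia.
  move: j Hj Hodd; do 8?[case=> //] => _ _; rewrite /= ?addn0 ?addn1 ?addn2 ?addn3.
  + by rewrite x0.
  + by rewrite x1.
  + by rewrite x2.
  + by rewrite x3.
- by apply: (@BadPow4 _ _ (2 * i) (2 * k));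
    [lia | lia | apply: eqs_sub (eqs_itail_idelta e) _ _ _; lia].
apply: (@BadPat _ _ (2 * i) (2 * k) (2 * l)); try lia.
- by apply: eqs_sub (eqs_itail_idelta e1) _ _ _; lia.
- by apply: eqs_sub (eqs_itail_idelta e2) _ _ _; lia.
- by apply: eqs_sub (eqs_itail_idelta e3) _ _ _; lia.
Qed.

(** Only occurrences at position 0 are new, and both repetitions begin with a cube there. The first
    letters exclude an odd period; an even period 2(g+1) copies the leading 0 and the images of 001,
    so that [w] reads 1001 at position g. *)
Lemma bad_icons_idelta w N : ~~ w 0 -> ~~ w 1 -> w 2 ->
  bad (icons false (idelta w)) N -> bad w N./2.
Proof.
move=> /negbTE w0 /negbTE w1 w2; set x := icons _ _.
have xE i m : i = 2 * m + 2 -> x i = ~~ w m.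
  by move=> ->; rewrite addn2 /= (idelta_odd w (m := m)) //; lia.
have x0 i : odd i || (i == 0) -> x i = false.
  by case: i => //= i Hi; apply: idelta_even; lia.
have cube k : 0 < k -> 3 * k <= N -> eqs x 0 k (2 * k) -> bad w N./2.
  move=> k0 HN e; case: (boolP (odd k)) => Hk.
    have [k1|k1] := leqP k 1.
      have: x 1 = x 2 by apply: eqsE e _ _; lia.
      by rewrite x0 // (xE 2 0) // w0.
    have: x 2 = x (k + 2) by apply: eqsE e _ _; lia.
    by rewrite (xE 2 0) // w0 x0 //; lia.
  have [g kg] : exists g, k = 2 * g.+1 by exists (k./2 - 1); lia.
  rewrite {k}kg in k0 HN e Hk *.
  have wg : w g.
    have: x 0 = x (2 * g.+1) by apply: eqsE e _ _; lia.
    by rewrite x0 // (xE _ g) => [/esym/negbFE|]; last lia.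
  have g2 : 2 <= g by case: g wg {k0 HN e Hk} => [|[|//]]; rewrite ?w0 ?w1.
  have e2 : x 2 = x (2 * g.+1 + 2) by apply: eqsE e _ _; lia.
  have e4 : x 4 = x (2 * g.+2 + 2) by apply: eqsE e _ _; lia.
  have e6 : x 6 = x (2 * g.+3 + 2) by apply: eqsE e _ _; lia.
  rewrite (xE 2 0) // (xE _ g.+1) // w0 in e2.
  rewrite (xE 4 1) // (xE _ g.+2) // w1 in e4.
  rewrite (xE 6 2) // (xE _ g.+3) // w2 in e6.
  apply: (@Bad1001 _ _ g) => //; try by rewrite -?e2 -?e4.
    by clear -HN g2; lia.
  exact: negbFE.
case=> [[|i]|[|i]|[|i] k|[|i] k l] //; try by [apply: cube; lia].
- move=> HN x1 x2; apply: bad_idelta; apply: bad_leq (@Bad11 _ i.+2 i _ x1 x2); lia.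
- move=> HN x1 x2 x3 x4; apply: bad_idelta.
  by apply: bad_leq (@Bad1001 _ i.+4 i _ x1 x2 x3 x4); lia.
- by move=> k0 HN e; apply: cube k0 _ _; [lia | apply: eqs_sub e _ _ _; lia].
- by move=> k0 HN e; apply: bad_idelta; apply: (@BadPow4 _ _ i k) => //; lia.
- by move=> k0 l0 HN e *; apply: cube k0 _ _; [lia | apply: eqs_sub e _ _ _; lia].
- by move=> k0 l0 HN *; apply: bad_idelta; apply: (@BadPat _ _ i k l) => //; lia.
Qed.

(* A forbidden repetition starting with the first letter has all its periods
   divisible by 4, hence can be shifted to the right by one. *)
Lemma bad_itail_mod4 (x : iword) N :
  (forall i, i %% 4 = 0 -> x i) -> (forall i, odd i -> ~~ x i) -> ~~ x 2 ->
  bad x N -> bad (itail x) N.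
Proof.
move=> x4 x1 x2.
(* A 1 at position 0 excludes odd shifts, and a 0 at position 2 excludes shifts congruent to 2
   modulo 4. *)
have per b n : 2 < n -> eqs x 0 b n -> b %% 4 = 0.
  move=> n2 e; have e0 : x 0 = x b by apply: eqsE e _ _; lia.
  have e2 : x 2 = x (b + 2) by apply: eqsE e _ _; lia.
  case: (boolP (odd b)) => Hb; first by move: (x1 _ Hb); rewrite -e0 x4.
  case: (b %% 4 =P 2) => Hb2; last by lia.
  by move: x2; rewrite e2 x4 //; lia.
(* The shift brings one new letter into each block; both new positions are multiples of 4, so both
   letters are 1. *)
have shift a b n : a %% 4 = 0 -> b %% 4 = 0 -> n %% 4 = 0 ->
    eqs x a b n -> eqs (itail x) a b n.
  move=> Ha Hb Hn e j Hj; rewrite /itail.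
  have [Hj2|Hj2] := ltnP j.+1 n; first by apply: eqsE e _ _; lia.
  by rewrite !x4 //; lia.
case=> [[|i]|[|i]|[|i] k|[|i] k l] //.
- by move=> _ _ x_1; move: (x1 1); rewrite x_1 => /(_ isT).
- by move=> HN ? ?; apply: (@Bad11 _ _ i) => //; lia.
- by move=> _ _ _ _ x_3; move: (x1 3); rewrite x_3 => /(_ isT).
- by move=> HN ? ? ? ?; apply: (@Bad1001 _ _ i) => //; lia.
- move=> k0 HN e; have k4 : k %% 4 = 0 by apply: per e; lia.
  by apply: (@BadPow4 _ _ 0 k) => //; apply: shift => //; lia.
- by move=> k0 HN e; apply: (@BadPow4 _ _ i k) => //; lia.
- move=> k0 l0 HN e1 e2 e3; have k4 : k %% 4 = 0.
    have [k1|k1] := leqP 2 k; first by apply: per e1; lia.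
    have: x 0 = x 1 by apply: eqsE e1 _ _; lia.
    by rewrite x4 // => /esym E; move: (x1 1); rewrite E => /(_ isT).
  have l4 : l %% 4 = 0.
    have E : eqs x 0 (3 * k + l) k.
      apply: (@eqs_trans _ _ (2 * k)); last by apply: eqs_sub e2 _ _ _; lia.
      apply: (@eqs_trans _ _ k); first by apply: eqs_sub e1 _ _ _; lia.
      by apply: eqs_sub e1 _ _ _; lia.
    have : (3 * k + l) %% 4 = 0 by apply: per E; lia.
    by lia.
  by apply: (@BadPat _ _ 0 k l) => //; apply: shift => //; lia.
- by move=> k0 l0 HN *; apply: (@BadPat _ _ i k l) => //; lia.
Qed.

(** * Desubstitution *)

Definition starts01 (y : iword) := ~~ y 0 && y 1.
Definition undelta (x : iword) : iword := fun m => ~~ x (2 * m + 1).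

(** Consider the first even position holding 1. Avoiding 11 and then 1001 puts 0 at the two odd
    positions before it, so it is preceded by 0000; for position 2 the prefix 01 already gives
    11. *)
Lemma good_idelta x : good x -> starts01 x -> x =1 idelta (undelta x).
Proof.
move=> /goodP g /andP[/negbTE x0 x1].
have ev n : x (2 * n) = false.
  elim/ltn_ind: n => n IH; apply/negbTE/negP => xn.
  case: n => [|n] in IH xn *; first by rewrite x0 in xn.
  have z1 : x (2 * n + 1) = false.
    apply/negbTE/negP => z; apply: (g (2 * n + 3)).
    apply: (@Bad11 _ _ (2 * n + 1)) => //; first by lia.
    by have <- : 2 * n.+1 = (2 * n + 1).+1 by lia.
  case: n => [|n] in IH xn z1 *; first by rewrite x1 in z1.
  have z2 : x (2 * n + 1) = false.
    apply/negbTE/negP => z; apply: (g (2 * n + 5)).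
    apply: (@Bad1001 _ _ (2 * n + 1)) => //; first by lia.
    - by rewrite (_ : (2 * n + 1).+1 = 2 * n.+1) ?IH //; lia.
    - by rewrite (_ : (2 * n + 1).+2 = 2 * n.+1 + 1) ?z1 //; lia.
    - by have <- : 2 * n.+2 = (2 * n + 1).+3 by lia.
  apply: (g (2 * n + 4)); apply: (@zeros4_bad _ (2 * n)) => // j Hj.
  have : [|| j == 2 * n, j == 2 * n + 1, j == 2 * n.+1 | j == 2 * n.+1 + 1] by lia.
  by case/or4P => /eqP -> //; apply: IH; lia.
move=> i; case: (boolP (odd i)) => Hi.
  rewrite (idelta_odd _ (m := i./2)) /undelta; last by lia.
  by rewrite negbK; congr x; lia.
by rewrite idelta_even // -[RHS](ev i./2); congr x; lia.
Qed.

(** * The transitions *)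

Definition op_prefix (f : op) : word :=
  match f with Alpha => [::] | Beta => [:: false] | Gamma => [:: false; false] end.

Definition state_prefix (q : state) : word :=
  match q with
  | Sa => [::] | Sb => [:: false] | Sc => [:: false; false] | Sd => [:: true]
  end.

(** The word 100y has 1 at all multiples of 4 and at no odd position, so a repetition using its
    first letter can be shifted past it. *)
Lemma bad_100 y N : starts01 y -> (forall m, y (4 * m + 1)) ->
  (forall i, ~~ odd i -> ~~ y i) ->
  bad (iapp [:: true; false; false] y) N -> bad (iapp [:: false; false] y) N.
Proof.
move=> h y1 y0; apply: (@bad_itail_mod4 (iapp [:: true; false; false] y)) => //.
- move=> [|[|[|i]]] //= Hi; have -> : i = 4 * i./2./2 + 1 by lia.
  exact: y1.
- by move=> [|[|[|i]]] //= Hi; apply: y0; lia.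
Qed.

(** The words 0 delta(z) and 00 delta(z) are suffixes of delta(1z), and 1 delta(z) is one of
    delta(0z). Restoring at most one letter thus gives an image under delta, whence the bound
    (N+1)/2. *)
Lemma bad_step q f q' y y' N : trans q f q' -> starts01 y' ->
  (forall i, ~~ odd i -> ~~ y' i) -> (f = Gamma -> forall m, y' (4 * m + 1)) ->
  y =1 idelta (iapp (op_prefix f) y') ->
  bad (iapp (state_prefix q) y) N -> bad (iapp (state_prefix q') y') N.+1./2.
Proof.
move=> t h ev od e /(bad_ext (iapp_ext _ e)).
have [/negbTE y0 y1] := andP h.
have leN := @bad_leq _ N./2 N.+1./2.
have b1 z : bad (icons false (idelta z)) N -> bad (icons true z) N.+1./2.
  move=> /(@bad_icons false)/(bad_ext (fsym (idelta_icons true z))).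
  exact: bad_idelta.
have b2 z : bad (icons false (icons false (idelta z))) N -> bad (icons true z) N.+1./2.
  move=> /(bad_ext (fsym (idelta_icons true z)))/bad_idelta.
  by apply: bad_leq; lia.
have b3 z : bad (icons true (idelta z)) N -> bad (icons false z) N.+1./2.
  move=> /(@bad_icons false)/(bad_ext (fsym (idelta_icons false z))).
  exact: bad_idelta.
case: t od {e} => /= od.
- by move/bad_idelta; apply: leN; lia.
- by move/bad_idelta; apply: leN; lia.
- by move/bad_idelta; apply: leN; lia.
(* For the loop at b, completing to delta(10y') would be useless, as 10y' itself begins with
   1001. *)
- move/bad_icons_idelta => /= H; apply: leN; first by lia.
  by apply: H; rewrite ?y0.
- exact: b1.
- by move/b1/bad_100; apply=> //; apply: od.
- by move/b2/bad_100; apply=> //; apply: od.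
- exact: b2.
- exact: b3.
- exact: b3.
Qed.

(** A total version of [trans]: the two missing transitions, beta from c and gamma from d, get the
    dummy value [Sc]. *)
Definition step (q : state) (f : op) : state :=
  match q, f with
  | Sa, Alpha => Sa
  | Sa, Beta | Sb, Beta | Sd, Alpha => Sb
  | Sb, Alpha | Sc, Alpha => Sd
  | _, _ => Sc
  end.

Lemma good_itail_idelta w : ~~ [&& w 0, ~~ w 1, ~~ w 2 & w 3] ->
  good (itail (idelta w)) -> good w.
Proof.
by move=> w0 /goodP g; apply/goodP => N /(bad_itail_idelta w0); apply: g.
Qed.

(** Dropping the first letter of delta(1z) or delta(0z) leaves 0 delta(z) or 1 delta(z); goodness of
    this tail gives goodness of 1z or 0z unless that word begins with 1001. The two missing
    transitions produce a forbidden pattern. *)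
Lemma good_step q f y y' : starts01 y' -> y =1 idelta (iapp (op_prefix f) y') ->
  good (iapp (state_prefix q) y) ->
  trans q f (step q f) /\ good (iapp (state_prefix (step q f)) y').
Proof.
move=> h e /(good_ext (iapp_ext _ e)).
have [/negbTE y0 y1] := andP h.
have g1 z : good (icons false (idelta z)) ->
    ~~ [&& ~~ z 0, ~~ z 1 & z 2] -> good (icons true z).
  move=> g z0; apply: good_itail_idelta => //.
  by apply: good_ext g => i; rewrite /itail idelta_icons.
have g2 z : good (icons true (idelta z)) -> good (icons false z).
  move=> g; apply: good_itail_idelta => //.
  by apply: good_ext g => i; rewrite /itail idelta_icons.
have g0 z : ~~ z 0 -> good (idelta z) -> good z.
  move=> z0 g; apply: good_itail_idelta; first by rewrite (negbTE z0).
  apply: (@good_icons (idelta z 0)); apply: good_ext g.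
  by case.
have g00 : good (idelta (iapp (op_prefix f) y')) -> good (iapp (op_prefix f) y').
  by apply: g0; case: f {e} => //=; rewrite y0.
case: q f {e} g00 => [] [] g00 /= g.
- by split; [constructor | exact: g00].
- by split; [constructor | exact: g00].
- by split; [constructor | exact: g00].
- by split; [constructor | apply: (g1 _ g); rewrite y1 andbF].
- by split; [constructor | apply: g00; apply: good_icons g].
- by split; [constructor | apply: g00; apply: good_icons g].
- by split; [constructor | apply: (g1 _ (good_icons g)); rewrite y1 andbF].
(* Beta from c: 00 delta(001...) begins with 00010100. *)
- move/goodP: g => /(_ 8) []; apply: (@bad_00010100 _ 0) => // j.
  by do 8?[case: j => [|j]] => //= _; rewrite /idelta //= ?y0 ?y1.
- by split; [constructor | apply: g00; apply: good_icons (good_icons g)].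
- by split; [constructor | exact: g2].
- by split; [constructor | exact: g2].
(* Gamma from d: 000y' begins with 0000. *)
move/g2/goodP: g => /(_ 4) []; apply: (@zeros4_bad _ 0) => // j.
by do 4?[case: j => [|j]].
Qed.

(** * The infinite words 01 . f *)

Lemma is_prefixP u (x : iword) :
  prefix_of u x <-> forall j, j < size u -> x j = nth false u j.
Proof. exact: (factor_atP u x 0). Qed.

Lemma prefix_of_iapp u v x : prefix_of v x -> prefix_of (u ++ v) (iapp u x).
Proof.
move=> p; elim: u => //= a u /is_prefixP IH; apply/is_prefixP => -[|j] //=.
exact: IH.
Qed.

Lemma nth_delta v j : j < 2 * size v ->
  nth false (delta v) j = odd j && ~~ nth false v j./2.
Proof.
elim: v j => [|a v IH] [|[|j]] //=; first by case: a.
- by case: a.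
- by rewrite negbK => Hj; rewrite -IH; [case: a | lia].
Qed.

Lemma prefix_of_idelta v x : prefix_of v x -> prefix_of (delta v) (idelta x).
Proof.
move=> /is_prefixP p; apply/is_prefixP => j; rewrite size_delta => Hj.
by rewrite nth_delta // /idelta p //; lia.
Qed.

Lemma prefix_of_ext u x y : x =1 y -> prefix_of u x -> prefix_of u y.
Proof. by rewrite /prefix_of => /eq_mkseq ->. Qed.

Lemma last_deltan n s a : last false (deltan n (rcons s a)) = odd n (+) a.
Proof.
elim: n s a => [|n IH] s a; first by rewrite last_rcons.
have -> : deltan n.+1 (rcons s a) = deltan n (rcons (rcons (delta s) false) (~~ a)).
  by rewrite /deltan iterSr -!cats1 delta_cat -catA; case: a.
by rewrite IH /= addbN addNb.
Qed.

(* The last letter fixes the parity of the level, and the length of w excludes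
   levels beyond n + 1. *)
Lemma level_deltan n y : size y + 4 <= 2 ^ n.+2 ->
  level (y ++ deltan n [:: false; true]) = n.
Proof.
move=> Hy; set w := y ++ _.
have sn : suffix (deltan n [:: false; true]) w by apply: suffix_suffix.
have [sl /(_ n sn) ln] := levelP sn.
set m := level w in sl ln *.
have nm : odd n = odd m.
  have lw k : suffix (deltan k [:: false; true]) w -> last false w = ~~ odd k.
    case/suffixP => v ->; have E := last_deltan k [:: false] true.
    rewrite /= addbT in E; rewrite last_cat -E.
    have : 0 < size (deltan k [:: false; true]) by rewrite size_deltan muln_gt0 expn_gt0.
    by case: deltan.
  by apply: negb_inj; rewrite -!lw.
apply/eqP; rewrite eqn_leq ln andbT leqNgt; apply/negP => lt_nm.
have {nm lt_nm} n2 : n.+2 <= m by lia.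
have := size_suffix sl; rewrite size_cat !size_deltan /=.
have : 2 ^ n.+2 <= 2 ^ m by rewrite leq_exp2l.
by move: Hy; rewrite !expnS; lia.
Qed.

(** The word y for which applying the first n operators to 01 gives y delta^n(01). *)
Fixpoint ops_prefix (f : nat -> op) n : word :=
  if n is m.+1 then ops_prefix f m ++ deltan m.+1 (op_prefix (f m)) else [::].

(** The length is at most 2(2 + ... + 2^n) = 2^(n+2) - 4, as [level_deltan] requires. *)
Lemma size_ops_prefix f n : size (ops_prefix f n) + 4 <= 2 ^ n.+2.
Proof.
elim: n => //= n IH; rewrite size_cat (size_deltan n.+1).
have s2 : size (op_prefix (f n)) <= 2 by case: (f n).
by have := leq_mul (leqnn (2 ^ n.+1)) s2; move: IH; rewrite !expnS; lia.
Qed.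

Lemma apply_ops_prefix f n :
  apply_ops f n [:: false; true] = ops_prefix f n ++ deltan n [:: false; true].
Proof.
elim: n => //= n IH.
have l : level (apply_ops f n [:: false; true]) = n.
  by rewrite IH level_deltan ?size_ops_prefix.
rewrite (apply_opE (f n) (y := ops_prefix f n)) l // -catA.
by congr (_ ++ _); rewrite -(deltan_cat n.+1); case: (f n).
Qed.

Lemma ops_prefixS f n : ops_prefix f n.+1 =
  delta (op_prefix (f 0) ++ ops_prefix (fun i => f i.+1) n).
Proof.
elim: n => [|n IH]; first by rewrite /= cats0.
by rewrite [LHS]/= -/(ops_prefix f n.+1) IH /= !delta_cat catA.
Qed.

(** Every block appended after the seed is an image under delta; factoring one delta out turns
    operators acting at the right end into a decoding from the left. *)
Lemma apply_opsS f n : apply_ops f n.+1 [:: false; true] =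
  delta (op_prefix (f 0) ++ apply_ops (fun i => f i.+1) n [:: false; true]).
Proof. by rewrite !apply_ops_prefix ops_prefixS !delta_cat -!catA. Qed.

Lemma prefix_apply_opsS f n y' :
  prefix_of (apply_ops (fun i => f i.+1) n [:: false; true]) y' ->
  prefix_of (apply_ops f n.+1 [:: false; true]) (idelta (iapp (op_prefix (f 0)) y')).
Proof. by move=> p; rewrite apply_opsS; apply/prefix_of_idelta/prefix_of_iapp. Qed.

Lemma is_bullet_starts01 f y : is_bullet [:: false; true] f y -> starts01 y.
Proof.
move=> /(_ 1 isT)/is_prefixP p; rewrite /starts01.
have /prefixP[s E] := @prefix_apply_ops f 0 1 [:: false; true] isT.
by rewrite !p E.
Qed.

Lemma is_bullet_step f y : is_bullet [:: false; true] f y ->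
  exists y', is_bullet [:: false; true] (fun i => f i.+1) y' /\
    y =1 idelta (iapp (op_prefix (f 0)) y').
Proof.
move=> b; have [y' b'] := is_bullet_exists [:: false; true] (fun i => f i.+1).
exists y'; split=> //; apply: is_bullet_unique b _ => -[|n] // _.
(* [is_bullet] says nothing for n = 0, so the prefix 01 of [y'] is supplied separately. *)
apply: prefix_apply_opsS; case: n => [|n]; last exact: b'.
have /andP[/negbTE y0 y1] := is_bullet_starts01 b'.
by rewrite /prefix_of /mkseq /= y0 y1.
Qed.

Lemma good_bullet N q f y :
  (forall n, trans (q n) (f n) (q n.+1)) -> is_bullet [:: false; true] f y ->
  ~ bad (iapp (state_prefix (q 0)) y) N.
Proof.
elim/ltn_ind: N q f y => N IH q f y t b Hbad.
have [y' [b' e]] := is_bullet_step b.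
have [y'' [b'' e']] := is_bullet_step b'.
have t' n : trans (q n.+1) (f n.+1) (q n.+2) by apply: t.
(* A forbidden pattern has at least two letters, and N >= 2 makes (N+1)/2 < N. *)
have N2 : 2 <= N by case: Hbad; lia.
apply: (IH N.+1./2 _ (fun n => q n.+1) _ _ t' b'); first by lia.
apply: bad_step (t 0) (is_bullet_starts01 b') _ _ e Hbad => [i Hi|f0 m].
  by rewrite e' idelta_even.
(* After gamma the path is in c, so the next operator is gamma or alpha. It prepends an even number
   of 0s to [y''], whose even positions hold 0, and delta turns these into 1s at the positions 4m+1
   of [y']. *)
have [y3 [_ e'']] := is_bullet_step b''.
rewrite e' (idelta_odd _ (m := 2 * m)); last by lia.
have := t' 0; have := t 0; rewrite f0 => t0.
have -> : q 1 = Sc by inversion t0.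
have ev i : ~~ odd i -> ~~ y'' i by move=> Hi; rewrite e'' idelta_even.
move=> t1; inversion t1.
  by case: m => [|m]; [|rewrite mulnS] => //=; apply: ev; lia.
by apply: ev; lia.
Qed.

(** * Decoding a good word *)

Definition first_op (x : iword) : op :=
  if undelta x 1 then Alpha else if undelta x 2 then Beta else Gamma.

Definition inext (x : iword) : iword :=
  fun i => undelta x (i + size (op_prefix (first_op x))).

Lemma good_next x : good x -> starts01 x ->
  starts01 (inext x) /\ x =1 idelta (iapp (op_prefix (first_op x)) (inext x)).
Proof.
move=> g x01; have e := good_idelta g x01.
have w0 : undelta x 0 = false by case/andP: x01 => _; rewrite /undelta => ->.
rewrite /starts01 /inext /first_op.
case w1: (undelta x 1) => /=.
  rewrite w0 w1; split=> // i; rewrite e; apply: idelta_ext => j.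
  by rewrite addn0.
case w2: (undelta x 2) => /=.
  rewrite w1 w2; split=> // i; rewrite e; apply: idelta_ext => -[|j] //=.
  by rewrite addn1.
case w3: (undelta x 3) => /=.
  rewrite w2; split=> // i; rewrite e; apply: idelta_ext => -[|[|j]] //=.
  by rewrite addn2.
(* Otherwise [undelta x] begins with 0000, and [x] with the fourth power of 01. *)
move/goodP: g => /(_ 8) []; apply: (bad_ext (fsym e)).
apply: (@BadPow4 _ _ 0 2) => // j Hj.
by do 6?[case: j Hj => [|j] Hj] => //; rewrite /idelta /= ?w0 ?w1 ?w2 ?w3.
Qed.

Lemma is_bullet_sequence (f : nat -> op) (Y : nat -> iword) :
  (forall n, starts01 (Y n)) ->
  (forall n, Y n =1 idelta (iapp (op_prefix (f n)) (Y n.+1))) ->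
  is_bullet [:: false; true] f (Y 0).
Proof.
move=> h e n _; elim: n f Y h e => [|n IH] f Y h e.
  by have /andP[/negbTE y0 y1] := h 0; rewrite /prefix_of /mkseq /= y0 y1.
apply: prefix_of_ext (fsym (e 0)) _; apply: prefix_apply_opsS.
exact: (IH _ (fun n => Y n.+1)).
Qed.

Theorem theorem3p5 (x : iword) (hx : prefix_of [:: false; true] x) :
  good x <-> exists f : nat -> op, in_F f /\ is_bullet [:: false; true] f x.
Proof.
have x01 : starts01 x by move/is_prefixP: hx => hx; rewrite /starts01 !hx.
split=> [g|[f [[q [q0 t]] b]]]; last first.
  by apply/goodP => N; have := good_bullet t b; rewrite q0; apply.
pose Y n := iter n inext x; pose f n := first_op (Y n).
pose q := fix q n := if n is m.+1 then step (q m) (f m) else Sa.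
(* Goodness of [Y n] behind the prefix of its state both allows the next decoding and validates the
   next transition. *)
have inv n : good (iapp (state_prefix (q n)) (Y n)) /\ starts01 (Y n).
  elim: n => [|n [gn hn]] //=.
  have [h e] := good_next (good_iapp gn) hn.
  by split=> //; apply: (good_step h e gn).2.
have dec n : starts01 (Y n.+1) /\ Y n =1 idelta (iapp (op_prefix (f n)) (Y n.+1)).
  by have [gn hn] := inv n; apply: good_next (good_iapp gn) hn.
exists f; split.
  exists q; split=> // n; have [gn hn] := inv n.
  exact: (good_step (dec n).1 (dec n).2 gn).1.
exact: (@is_bullet_sequence f Y (fun n => (inv n).2) (fun n => (dec n).2)).
Qed.
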